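(* Let $m\ge 2$ and $n\ge 3$. The constant $\sqrt2$ is optimal in the inequality $$\Bigl\| \Bigl|\sum_{k=1}^m A_k\Bigr|_{\mathrm{sym}} \Bigr\|\ \le\ \sqrt2\,\Bigl\| \sum_{k=1}^m |A_k|_{\mathrm{sym}} \Bigr\|\qquad (A_1,\dots,A_m\in\mathbb{M}_n,\ \|\cdot\|\text{ a unitarily invariant norm on }\mathbb{M}_n),$$ that is, there is no real $c<\sqrt2$ such that $\bigl\| |\sum_{k=1}^m A_k|_{\mathrm{sym}} \bigr\|\le c\,\bigl\| \sum_{k=1}^m |A_k|_{\mathrm{sym}} \bigr\|$ for every unitarily invariant norm on $\mathbb{M}_n$ and all $A_1,\dots,A_m\in\mathbb{M}_n$. In fact, there exist $A,B\in\mathbb{M}_3$ such that $$\bigl\||A+B|_{\mathrm{sym}}\bigr\|_\infty=\sqrt2\,\bigl\||A|_{\mathrm{sym}}+|B|_{\mathrm{sym}}\bigr\|_\infty,$$ with $A,B$ not both zero, and moreover, for every $n>3$, setting $A_n:=A\oplus 0_{n-3}$ and $B_n:=B\oplus 0_{n-3}$ in $\mathbb{M}_n$, one has $$\bigl\||A_n+B_n|_{\mathrm{sym}}\bigr\|_\infty=\sqrt2\,\bigl\||A_n|_{\mathrm{sym}}+|B_n|_{\mathrm{sym}}\bigr\|_\infty.$$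
   Context: $\mathbb{M}_n$ is the set of $n\times n$ complex matrices, $Z^*$ is the conjugate transpose of $Z$, $|Z|:=(Z^*Z)^{1/2}$, and the arithmetic symmetric modulus is $|Z|_{\mathrm{sym}}:=\frac{|Z|+|Z^*|}{2}$. A norm $\|\cdot\|$ on $\mathbb{M}_n$ is unitarily invariant if $\|UZV\|=\|Z\|$ for all $Z\in\mathbb{M}_n$ and all unitaries $U,V\in\mathbb{M}_n$. $\|\cdot\|_\infty$ denotes the operator norm (largest singular value), and $0_{k}$ is the $k\times k$ zero matrix. The displayed inequality with constant $\sqrt2$ is a known theorem of Bourin and Lee; the claim here concerns the optimality of the constant. *)

(* Defs.v *)
From HB Require Import structures.
From mathcomp Require Import all_boot all_order all_algebra.
From mathcomp Require Import reals.
From mathcomp.real_closed Require Import complex.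

Set Implicit Arguments.
Unset Strict Implicit.
Unset Printing Implicit Defensive.

Import Order.TTheory GRing.Theory Num.Theory.
Local Open Scope ring_scope.
Local Open Scope complex_scope.
Local Open Scope sesquilinear_scope.

(* The square root of H in the continuous functional calculus.  It is the
   positive semidefinite square root only when H is positive semidefinite, since
   spectralmx and spectral_diag diagonalize H only when H is normal. *)
Definition psd_sqrtmx (R : realType) (n : nat) (H : 'M[R[i]]_n) : 'M[R[i]]_n :=
  (spectralmx H)^t* *m diag_mx (map_mx sqrtC (spectral_diag H)) *m spectralmx H.

Definition modmx (R : realType) (n : nat) (Z : 'M[R[i]]_n) : 'M[R[i]]_n :=
  psd_sqrtmx (Z^t* *m Z).

Definition symmodmx (R : realType) (n : nat) (Z : 'M[R[i]]_n) : 'M[R[i]]_n :=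
  2^-1 *: (modmx Z + modmx (Z^t*)).

Definition singular_values (R : realType) (n : nat) (Z : 'M[R[i]]_n) :
    'rV[R[i]]_n :=
  map_mx sqrtC (spectral_diag (Z^t* *m Z)).

(* The singular values are nonnegative complex numbers, so taking real parts and
   starting the maximum at 0 loses nothing. *)
Definition opnorm (R : realType) (n : nat) (Z : 'M[R[i]]_n) : R :=
  \big[Num.max/0]_(j < n) complex.Re (singular_values Z 0 j).

(* Nonnegativity of N follows from the triangle inequality and homogeneity.
   The norm of a : R[i] is itself an element of R[i], hence the real part. *)
Definition is_norm (R : realType) (n : nat) (N : 'M[R[i]]_n -> R) : Prop :=
  [/\ forall X Y, N (X + Y) <= N X + N Y,
      forall (a : R[i]) X, N (a *: X) = complex.Re `|a| * N X
    & forall X, N X = 0 -> X = 0].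

Definition unitarily_invariant (R : realType) (n : nat)
    (N : 'M[R[i]]_n -> R) : Prop :=
  forall Z U V : 'M[R[i]]_n, U \is unitarymx -> V \is unitarymx ->
    N (U *m Z *m V) = N Z.

(* The direct sum of A with the zero matrix of size n - p; the cast identifies
   p + (n - p) with n. *)
Definition dsum0 (R : realType) (p n : nat) (le_pn : (p <= n)%N)
    (A : 'M[R[i]]_p) : 'M[R[i]]_n :=
  castmx (subnKC le_pn, subnKC le_pn)
    (block_mx A 0 0 (0 : 'M[R[i]]_(n - p))).

(* Main.v *)
Require Import Defs.
From mathcomp Require Import all_boot all_order all_algebra.
From mathcomp Require Import ring.
From mathcomp Require Import reals.
From mathcomp.real_closed Require Import complex.

Import Order.TTheory GRing.Theory Num.Theory.
Local Open Scope ring_scope.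
Local Open Scope complex_scope.
Local Open Scope sesquilinear_scope.

Set Implicit Arguments.
Unset Strict Implicit.

(** Why sqrt 2 cannot be lowered.

    Write s for sqrt 2.  In the orthonormal basis z, x, y of C^3, consider
    the two rank-one matrices A, B that send the plane <z, x> to <x, y> with
    blocks [[s, 1], [2, s]] and [[s, -1], [-2, s]] (rows x, y; columns z, x).
    In their sum the off-diagonal entries cancel, and A + B is 2s times the
    partial shift z -> x -> y.  Its modulus is 2s on <z, x> and its
    co-modulus is 2s on <x, y>; both see x, so the symmetric modulus of A + B
    is s diag(1, 2, 1), of norm 2s.  On the other side |A| + |B| is
    diag(4, 2, 0) and |A^*| + |B^*| is diag(0, 2, 4): each is lopsided, but
    their average is the scalar matrix 2.  The ratio of the norms is s.

    The pair is found by looking for equality in the Cauchy-Schwarz proof of the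
    upper bound s: at a top vector x of |A + B|_sym, with image direction y and
    preimage direction z, the sum of the moduli has to be proportional to
    diag(2, 1, 0) on z, x, y, and the sum of the co-moduli to diag(0, 1, 2).

    All moduli that occur are computed by one remark: A, B and A + B are
    positive multiples c V of partial isometries V, that is
    Z Z^* Z = c^2 Z, and then |Z| = c^-1 Z^* Z
    ([modmx_scaled_pisometry]).  The relation survives
    compression Z |-> E^* Z E by any E with E E^* = 1, which covers at once
    the matrices of size 3 and their direct sums with zero blocks
    ([scaled_pisometry_compression], [dsum0_compression]).

    The operator norm itself refutes any constant c < s.  It is shown to be a
    unitarily invariant norm through its variational characterization
    [opnorm_leP]: opnorm Z is the least c >= 0 with |Z x| <= c |x| for all x.
    With more than two summands the remaining ones are taken to be zero. *)

(** * Adjoints and unitary matrices *)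

Lemma trmxC_mul (C : numClosedFieldType) (m n p : nat)
    (X : 'M[C]_(m, n)) (Y : 'M[C]_(n, p)) :
  (X *m Y)^t* = Y^t* *m X^t*.
Proof. by rewrite trmx_mul map_mxM. Qed.

Lemma trmxC_scale (C : numClosedFieldType) (m n : nat) (a : C) (X : 'M[C]_(m, n)) :
  (a *: X)^t* = a^* *: X^t*.
Proof. by rewrite linearZ map_mxZ. Qed.

Lemma trmxC_sub (C : numClosedFieldType) (m n : nat) (X Y : 'M[C]_(m, n)) :
  (X - Y)^t* = X^t* - Y^t*.
Proof. by apply/matrixP=> i j; rewrite !mxE rmorphB. Qed.

Lemma unitarymx_trmxCl (C : numClosedFieldType) (n : nat) (U : 'M[C]_n) :
  U \is unitarymx -> U^t* *m U = 1%:M.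
Proof. by rewrite -trmxC_unitary => /unitarymxP; rewrite trmxCK. Qed.

(** * Moduli of multiples of partial isometries *)

Lemma gram_spectral (C : numClosedFieldType) (n : nat) (Z : 'M[C]_n) :
  let H := Z^t* *m Z in
  H = (spectralmx H)^t* *m diag_mx (spectral_diag H) *m spectralmx H.
Proof.
move=> H; rewrite -invmx_unitary ?spectral_unitarymx //.
by apply/orthomx_spectralP/normalmxP; rewrite /H trmxC_mul trmxCK.
Qed.

(** Partial isometries V are characterized by V V^* V = V; here V = Z / c. *)
Definition scaled_pisometry (C : numClosedFieldType) (n : nat) (c : C) (Z : 'M[C]_n) :=
  0 < c /\ Z *m Z^t* *m Z = c ^+ 2 *: Z.

(** The symmetric modulus of Z when Z is c times a partial isometry. *)
Definition gram_average (C : numClosedFieldType) (n : nat) (c : C) (Z : 'M[C]_n) :=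
  (2 * c)^-1 *: (Z^t* *m Z + Z *m Z^t*).

Lemma scaled_pisometry_trmxC (C : numClosedFieldType) (n : nat) (c : C)
    (Z : 'M[C]_n) :
  scaled_pisometry c Z -> scaled_pisometry c (Z^t*).
Proof.
move=> [c_gt0 /(congr1 (fun X => X^t*))]; rewrite /scaled_pisometry c_gt0.
rewrite !trmxC_mul !trmxCK mulmxA => ->; split=> //.
by rewrite trmxC_scale rmorphXn /= conj_Creal ?ger0_real ?ltW.
Qed.

(** The Gram matrix H = Z^* Z satisfies H^2 = c^2 H, so each of its eigenvalues
    is 0 or c^2, and on these two points the square root is division by c. *)
Lemma modmx_scaled_pisometry (R : realType) (n : nat) (c : R[i])
    (Z : 'M[R[i]]_n) :
  scaled_pisometry c Z -> modmx Z = c^-1 *: (Z^t* *m Z).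
Proof.
move=> [c_gt0 ZZZ]; have c_neq0 := lt0r_neq0 c_gt0.
rewrite /modmx /psd_sqrtmx; have := gram_spectral Z; rewrite /=.
set H := _ *m Z; set U := spectralmx H; set d := spectral_diag H => HE.
have Uu : U \is unitarymx by exact: spectral_unitarymx.
have HH : H *m H = c ^+ 2 *: H.
  by rewrite /H -!mulmxA [Z *m _]mulmxA ZZZ -scalemxAr.
(* Opaque from here on: reassociation would otherwise reach inside H. *)
clearbody H.
have dE : diag_mx d = U *m H *m U^t*.
  by rewrite HE !mulmxA (unitarymxP Uu) mul1mx -mulmxA (unitarymxP Uu) mulmx1.
have d2 j : d 0 j ^+ 2 = c ^+ 2 * d 0 j.
  have : diag_mx d *m diag_mx d = c ^+ 2 *: diag_mx d.
    rewrite dE -!mulmxA [U^t* *m (U *m _)]mulmxA (unitarymx_trmxCl Uu) mul1mx.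
    by rewrite [H *m (H *m _)]mulmxA HH -!scalemxAl -scalemxAr.
  move/matrixP/(_ j j); rewrite mulmx_diag !mxE eqxx !mulr1n => <-.
  by rewrite expr2.
have -> : map_mx sqrtC d = c^-1 *: d.
  apply/rowP=> j; rewrite !mxE.
  have [->|dj] := eqVneq (d 0 j) 0; first by rewrite sqrtC0 mulr0.
  have -> : d 0 j = c ^+ 2 by apply: (mulIf dj); rewrite -d2 expr2.
  by rewrite sqrCK ?ltW // expr2 mulKf.
by rewrite linearZ /= -scalemxAr -scalemxAl -HE.
Qed.

Lemma symmodmx_scaled_pisometry (R : realType) (n : nat) (c : R[i])
    (Z : 'M[R[i]]_n) :
  scaled_pisometry c Z -> symmodmx Z = gram_average c Z.
Proof.
move=> Zc; rewrite /symmodmx (modmx_scaled_pisometry Zc).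
rewrite (modmx_scaled_pisometry (scaled_pisometry_trmxC Zc)) trmxCK.
by rewrite -scalerDr scalerA -invfM.
Qed.

Lemma symmodmx0 (R : realType) (n : nat) : symmodmx (0 : 'M[R[i]]_n) = 0.
Proof.
have Z1 : scaled_pisometry 1 (0 : 'M[R[i]]_n).
  by split; [exact: ltr01 | rewrite !(mulmx0, mul0mx) scaler0].
have -> := symmodmx_scaled_pisometry Z1.
by rewrite /gram_average !(mulmx0, mul0mx) addr0 scaler0.
Qed.

(** * Compressions and direct sums with zero *)

Definition compression (C : numClosedFieldType) (m n : nat) (E : 'M[C]_(m, n))
    (Z : 'M[C]_m) : 'M[C]_n :=
  E^t* *m Z *m E.

(** As E E^* = 1, compression by E is a homomorphism of *-algebras, without
    unit; it transports every identity in Z and Z^*. *)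
Section Compression.
Variables (C : numClosedFieldType) (m n : nat) (E : 'M[C]_(m, n)).

Lemma compressionD X Y : compression E (X + Y) = compression E X + compression E Y.
Proof. by rewrite /compression mulmxDr mulmxDl. Qed.

Lemma compressionZ a X : compression E (a *: X) = a *: compression E X.
Proof. by rewrite /compression -scalemxAr -scalemxAl. Qed.

Lemma compression_trmxC X : (compression E X)^t* = compression E (X^t*).
Proof. by rewrite /compression !trmxC_mul trmxCK mulmxA. Qed.

Hypothesis Eu : E \is unitarymx.

Lemma compressionM X Y : compression E X *m compression E Y = compression E (X *m Y).
Proof.
by rewrite /compression !mulmxA -[_ *m E *m E^t*]mulmxA (unitarymxP Eu) mulmx1.
Qed.

Lemma scaled_pisometry_compression c Z :
  scaled_pisometry c Z -> scaled_pisometry c (compression E Z).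
Proof.
move=> [c_gt0 Zc]; split=> //.
by rewrite compression_trmxC !compressionM Zc compressionZ.
Qed.

Lemma gram_average_compression c Z :
  gram_average c (compression E Z) = compression E (gram_average c Z).
Proof.
by rewrite /gram_average compression_trmxC !compressionM compressionZ compressionD.
Qed.

End Compression.

Section SymmodmxCompression.
Variables (R : realType) (m n : nat) (E : 'M[R[i]]_(m, n)).
Hypothesis Eu : E \is unitarymx.
Implicit Types (c : R[i]) (A B D : 'M[R[i]]_m).

Lemma symmodmx_compression c A :
  scaled_pisometry c A ->
  symmodmx (compression E A) = compression E (gram_average c A).
Proof.
move=> Ac; have EAc := scaled_pisometry_compression Eu Ac.
by rewrite (symmodmx_scaled_pisometry EAc) gram_average_compression.
Qed.

Lemma symmodmx_compression_add c A B D :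
  scaled_pisometry c A -> scaled_pisometry c B ->
  gram_average c A + gram_average c B = D ->
  symmodmx (compression E A) + symmodmx (compression E B) = compression E D.
Proof.
move=> Ac Bc <-.
by rewrite (symmodmx_compression Ac) (symmodmx_compression Bc) compressionD.
Qed.

Lemma symmodmx_add_compression c A B D :
  scaled_pisometry c (A + B) -> gram_average c (A + B) = D ->
  symmodmx (compression E A + compression E B) = compression E D.
Proof. by move=> Sc <-; rewrite -compressionD (symmodmx_compression Sc). Qed.

End SymmodmxCompression.

(** The coisometry that keeps the first p coordinates of C^n. *)
Definition corner_mx (C : numClosedFieldType) (p n : nat) (le_pn : (p <= n)%N) :
    'M[C]_(p, n) :=
  castmx (erefl p, subnKC le_pn) (row_mx 1%:M 0).

Lemma corner_mx_unitary (C : numClosedFieldType) (p n : nat) (le_pn : (p <= n)%N) :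
  corner_mx C le_pn \is unitarymx.
Proof.
rewrite /corner_mx; move: (n - p)%N (subnKC le_pn) => q e; case: _ / e.
rewrite castmx_id; apply/unitarymxP.
by rewrite tr_row_mx map_col_mx mul_row_col trmx1 map_mx1 mul1mx mul0mx addr0.
Qed.

Lemma dsum0_compression (R : realType) (p n : nat) (le_pn : (p <= n)%N)
    (A : 'M[R[i]]_p) :
  dsum0 le_pn A = compression (corner_mx _ le_pn) A.
Proof.
rewrite /dsum0 /compression /corner_mx.
move: (n - p)%N (subnKC le_pn) => q e; case: _ / e.
rewrite !castmx_id tr_row_mx map_col_mx trmx1 map_mx1 trmx0 map_mx0.
by rewrite mul_col_mx mul1mx mul0mx mul_col_row !mulmx1 !mulmx0.
Qed.

(** * The Euclidean norm of a column *)

(** Routed through the inner product [dotmx] on rows, which supplies the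
    triangle inequality. *)
Definition vnorm (C : numClosedFieldType) (n : nat) (x : 'cV[C]_n) : C :=
  sqrtC (dotmx (x^t*) (x^t*)).

Section VNorm.
Variable C : numClosedFieldType.

Lemma vnorm_sqr n (x : 'cV[C]_n) : vnorm x ^+ 2 = (x^t* *m x) 0 0.
Proof. by rewrite /vnorm sqrtCK dotmxE trmxCK. Qed.

Lemma vnorm_ge0 n (x : 'cV[C]_n) : 0 <= vnorm x.
Proof. by rewrite /vnorm sqrtC_ge0 dnorm_ge0. Qed.

Lemma vnorm_sum n (x : 'cV[C]_n) : vnorm x ^+ 2 = \sum_i `|x i 0| ^+ 2.
Proof.
by rewrite vnorm_sqr mxE; apply: eq_bigr => i _; rewrite !mxE normCK mulrC.
Qed.

Lemma vnormD n (x y : 'cV[C]_n) : vnorm (x + y) <= vnorm x + vnorm y.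
Proof. rewrite /vnorm !linearD map_mxD /=; exact: triangle_lerif. Qed.

Lemma vnormZ n (a : C) (x : 'cV[C]_n) : vnorm (a *: x) = `|a| * vnorm x.
Proof.
apply: (@pexpIrn _ 2); rewrite ?nnegrE ?mulr_ge0 ?vnorm_ge0 //.
rewrite exprMn !vnorm_sum mulr_sumr; apply: eq_bigr => i _.
by rewrite mxE normrM exprMn.
Qed.

Lemma vnorm0_eq0 n (x : 'cV[C]_n) : vnorm x = 0 -> x = 0.
Proof.
move/eqP; rewrite /vnorm sqrtC_eq0 dnorm_eq0 => /eqP x0.
by rewrite -[x]trmxCK x0 trmx0 map_mx0.
Qed.

Lemma vnorm_coisometryl m n (E : 'M[C]_(m, n)) (x : 'cV[C]_m) :
  E \is unitarymx -> vnorm (E^t* *m x) = vnorm x.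
Proof.
move/unitarymxP=> EE; apply: (@pexpIrn _ 2); rewrite ?nnegrE ?vnorm_ge0 //.
by rewrite !vnorm_sqr trmxC_mul trmxCK -mulmxA [E *m _]mulmxA EE mul1mx.
Qed.

(** Pythagoras: E^* E is the orthogonal projection onto the row space of E, and
    |x|^2 - |E x|^2 is the squared length of the component x - E^* E x. *)
Lemma vnorm_coisometryr m n (E : 'M[C]_(m, n)) (x : 'cV[C]_n) :
  E \is unitarymx -> vnorm (E *m x) <= vnorm x.
Proof.
move=> /unitarymxP EE; rewrite -ler_sqr ?nnegrE ?vnorm_ge0 // -subr_ge0.
suff -> : vnorm x ^+ 2 - vnorm (E *m x) ^+ 2
    = vnorm (x - E^t* *m (E *m x)) ^+ 2 by rewrite exprn_ge0 ?vnorm_ge0.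
rewrite !vnorm_sqr trmxC_sub !trmxC_mul trmxCK mulmxBl !mulmxBr.
rewrite !mulmxA -[_ *m E *m E^t*]mulmxA EE mulmx1 subrr subr0.
by rewrite !mxE.
Qed.

Lemma vnorm_unitary n (U : 'M[C]_n) (x : 'cV[C]_n) :
  U \is unitarymx -> vnorm (U *m x) = vnorm x.
Proof. by move=> Uu; rewrite -{1}[U]trmxCK vnorm_coisometryl // trmxC_unitary. Qed.

Lemma vnorm_delta n (j : 'I_n) : vnorm (delta_mx j 0 : 'cV[C]_n) = 1.
Proof.
apply: (@pexpIrn _ 2); rewrite ?nnegrE ?vnorm_ge0 // expr1n vnorm_sum.
rewrite (bigD1 j) //= big1; first by rewrite mxE !eqxx normr1 expr1n addr0.
by move=> i ij; rewrite mxE (negPf ij) normr0 expr0n.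
Qed.

End VNorm.

(** Says that c bounds the operator norm of Z without mentioning singular
    values, which makes the norm axioms immediate. *)
Definition vbound (C : numClosedFieldType) (n : nat) (Z : 'M[C]_n) (c : C) :=
  forall x : 'cV[C]_n, vnorm (Z *m x) <= c * vnorm x.

Section VBound.
Variable C : numClosedFieldType.

Lemma gram_spectral_diag_norm n (Z : 'M[C]_n) (x : 'cV[C]_n) :
  let H := Z^t* *m Z in
  vnorm (Z *m x) ^+ 2
    = \sum_j spectral_diag H 0 j * `|(spectralmx H *m x) j 0| ^+ 2.
Proof.
move=> H; rewrite vnorm_sqr trmxC_mul -mulmxA [Z^t* *m _]mulmxA -/H.
rewrite {1}[H]gram_spectral -/H; set U := spectralmx H; set d := spectral_diag H.
rewrite -!mulmxA mulmxA -trmxC_mul mxE; apply: eq_bigr => j _.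
rewrite mul_diag_mx !mxE normCK; set y := (\sum_(_ < n) _).
by rewrite mulrCA [y * _]mulrC.
Qed.

Lemma vnorm_singular_vector n (Z : 'M[C]_n) (j : 'I_n) :
  let H := Z^t* *m Z in
  vnorm (Z *m ((spectralmx H)^t* *m delta_mx j 0)) = sqrtC (spectral_diag H 0 j).
Proof.
move=> H; have Uu : spectralmx H \is unitarymx by exact: spectral_unitarymx.
rewrite -[LHS]sqrCK ?vnorm_ge0 // gram_spectral_diag_norm -/H.
rewrite mulmxA (unitarymxP Uu) mul1mx (bigD1 j) //= big1.
  by rewrite mxE !eqxx normr1 expr1n mulr1 addr0.
by move=> i ij; rewrite mxE (negPf ij) normr0 expr0n mulr0.
Qed.

(** One direction is a weighted sum in the eigenbasis of Z^* Z, the other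
    evaluates the bound at the right singular vectors. *)
Lemma vbound_singularP n (Z : 'M[C]_n) (c : C) :
  0 <= c ->
  (vbound Z c <-> forall j, sqrtC (spectral_diag (Z^t* *m Z) 0 j) <= c).
Proof.
move=> c_ge0; set d := spectral_diag _.
have Uu := spectral_unitarymx (Z^t* *m Z).
split=> [le_c j|le_c x].
  rewrite -vnorm_singular_vector (le_trans (le_c _)) //.
  by rewrite vnorm_coisometryl // vnorm_delta mulr1.
rewrite -ler_sqr ?nnegrE ?mulr_ge0 ?vnorm_ge0 // exprMn.
rewrite gram_spectral_diag_norm -(vnorm_unitary x Uu) vnorm_sum.
rewrite mulr_sumr; apply: ler_sum => j _; rewrite ler_wpM2r ?exprn_ge0 //.
have d_ge0 : 0 <= sqrtC (d 0 j) by rewrite -vnorm_singular_vector vnorm_ge0.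
by rewrite -[X in X <= _]sqrtCK ler_sqr ?nnegrE.
Qed.

Lemma vboundD n (X Y : 'M[C]_n) (a b : C) :
  vbound X a -> vbound Y b -> vbound (X + Y) (a + b).
Proof.
by move=> Xa Yb x; rewrite mulmxDl mulrDl (le_trans (vnormD _ _)) // lerD.
Qed.

Lemma vboundZ n (X : 'M[C]_n) (a b : C) : vbound X b -> vbound (a *: X) (`|a| * b).
Proof. by move=> Xb x; rewrite -scalemxAl vnormZ -mulrA ler_wpM2l. Qed.

Lemma vbound0_eq0 n (X : 'M[C]_n) : vbound X 0 -> X = 0.
Proof.
move=> X0; apply/matrixP=> i j.
have : vnorm (X *m delta_mx j 0) = 0.
  by apply/eqP; rewrite eq_le vnorm_ge0 andbT (le_trans (X0 _)) // mul0r.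
by move/vnorm0_eq0; rewrite -colE => /matrixP/(_ i 0); rewrite !mxE.
Qed.

Lemma vbound_unitary n (Z U V : 'M[C]_n) (c : C) :
  U \is unitarymx -> V \is unitarymx -> vbound Z c -> vbound (U *m Z *m V) c.
Proof.
move=> Uu Vu Zc x; rewrite -!mulmxA vnorm_unitary //.
by rewrite (le_trans (Zc _)) // vnorm_unitary.
Qed.

Lemma vbound_diag_compression m n (E : 'M[C]_(m, n)) (c : C) (d : 'rV[C]_m) :
  E \is unitarymx -> 0 <= c -> (forall j, `|d 0 j| <= c) ->
  vbound (compression E (diag_mx d)) c.
Proof.
move=> Eu c_ge0 le_c x; rewrite /compression -!mulmxA vnorm_coisometryl //.
apply: (@le_trans _ _ (c * vnorm (E *m x))); last first.
  by rewrite ler_wpM2l // vnorm_coisometryr.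
rewrite -ler_sqr ?nnegrE ?mulr_ge0 ?vnorm_ge0 // exprMn !vnorm_sum.
rewrite mulr_sumr; apply: ler_sum => j _.
rewrite mul_diag_mx mxE normrM exprMn ler_wpM2r ?exprn_ge0 //.
by apply: lerXn2r; rewrite ?nnegrE.
Qed.

Lemma diag_compression_attained m n (E : 'M[C]_(m, n)) (b : C) (d : 'rV[C]_m)
    (k : 'I_m) :
  E \is unitarymx -> vbound (compression E (diag_mx d)) b -> `|d 0 k| <= b.
Proof.
move=> Eu /(_ (E^t* *m delta_mx k 0)).
rewrite /compression -!mulmxA [E *m (_ *m _)]mulmxA (unitarymxP Eu) mul1mx.
rewrite !vnorm_coisometryl // vnorm_delta mulr1.
suff -> : diag_mx d *m delta_mx k 0 = d 0 k *: delta_mx k 0 :> 'cV_m.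
  by rewrite vnormZ vnorm_delta mulr1.
apply/matrixP=> i j; rewrite mul_diag_mx !mxE.
by case: eqP => [->|_] //=; rewrite !mulr0.
Qed.

End VBound.

(** * The operator norm *)

Lemma Re_normC (R : realType) (a : R[i]) : (complex.Re `|a|)%:C = `|a|.
Proof. by rewrite RRe_real ?normr_real. Qed.

Section Opnorm.
Variables (R : realType) (n : nat).
Implicit Types X Y Z U V : 'M[R[i]]_n.

Lemma opnorm_ge0 Z : 0 <= opnorm Z.
Proof. exact: bigmax_ge_id. Qed.

Lemma opnorm_leP (c : R) Z : 0 <= c -> (opnorm Z <= c <-> vbound Z c%:C).
Proof.
move=> c_ge0; have cC_ge0 : 0 <= c%:C :> R[i] by rewrite ler0c.
have sE j : (complex.Re (singular_values Z 0 j))%:C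
    = sqrtC (spectral_diag (Z^t* *m Z) 0 j).
  rewrite /singular_values mxE RRe_real // ger0_real //.
  by rewrite -vnorm_singular_vector vnorm_ge0.
apply: iff_trans (iff_sym (vbound_singularP Z cC_ge0)).
split=> [le_c j|le_c].
  by rewrite -sE lecR (le_trans _ le_c) // /opnorm le_bigmax.
by apply: bigmax_le => // j _; rewrite -lecR sE.
Qed.

Lemma vbound_opnorm Z : vbound Z (opnorm Z)%:C.
Proof. by apply/opnorm_leP; rewrite ?opnorm_ge0. Qed.

Lemma opnormD X Y : opnorm (X + Y) <= opnorm X + opnorm Y.
Proof.
apply/opnorm_leP; rewrite ?addr_ge0 ?opnorm_ge0 // rmorphD.
by apply: vboundD; apply: vbound_opnorm.
Qed.

Lemma opnormZ_le (a : R[i]) X : opnorm (a *: X) <= complex.Re `|a| * opnorm X.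
Proof.
have a_ge0 : 0 <= complex.Re `|a| by rewrite -ler0c Re_normC.
apply/opnorm_leP; rewrite ?mulr_ge0 ?opnorm_ge0 // rmorphM /= Re_normC.
by apply: vboundZ; apply: vbound_opnorm.
Qed.

Lemma opnorm0_eq0 X : opnorm X = 0 -> X = 0.
Proof.
move=> X0; apply: vbound0_eq0; rewrite -[0]/(0%:C) -X0.
exact: vbound_opnorm.
Qed.

Lemma opnorm_is_norm : is_norm (@opnorm R n).
Proof.
split=> [X Y|a X|X]; [exact: opnormD| |exact: opnorm0_eq0].
apply/eqP; rewrite eq_le opnormZ_le andTb.
have [->|a0] := eqVneq a 0; first by rewrite normr0 mul0r opnorm_ge0.
have a_gt0 : 0 < complex.Re `|a| by rewrite -ltcR Re_normC normr_gt0.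
(* The reverse inequality is the direct one for a^-1 and a X. *)
have := opnormZ_le a^-1 (a *: X); rewrite scalerA mulVf // scale1r.
suff -> : complex.Re `|a^-1| = (complex.Re `|a|)^-1 by rewrite ler_pdivlMl.
by apply: complexI; rewrite fmorphV !Re_normC normfV.
Qed.

Lemma opnorm_unitary_le Z U V :
  U \is unitarymx -> V \is unitarymx -> opnorm (U *m Z *m V) <= opnorm Z.
Proof.
move=> Uu Vu; apply/opnorm_leP; first exact: opnorm_ge0.
exact: vbound_unitary Uu Vu (vbound_opnorm Z).
Qed.

Lemma opnorm_unitarily_invariant : unitarily_invariant (@opnorm R n).
Proof.
move=> Z U V Uu Vu; apply/eqP; rewrite eq_le opnorm_unitary_le // andTb.
have := @opnorm_unitary_le (U *m Z *m V) (U^t*) (V^t*).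
rewrite !trmxC_unitary !mulmxA (mulmxtVK _ Vu) (unitarymx_trmxCl Uu) mul1mx.
by move=> /(_ Uu Vu).
Qed.

(** For the extremal pair, |A + B|_sym and |A|_sym + |B|_sym are both compressed
    diagonal matrices; the norm is attained on the adjoint of the k-th row of E. *)
Lemma opnorm_diag_compression (m : nat) (E : 'M[R[i]]_(m, n)) (c : R)
    (d : 'rV[R[i]]_m) (k : 'I_m) :
  E \is unitarymx -> 0 <= c -> `|d 0 k| = c%:C -> (forall j, `|d 0 j| <= c%:C) ->
  opnorm (compression E (diag_mx d)) = c.
Proof.
move=> Eu c_ge0 dk le_c; apply/eqP; rewrite eq_le; apply/andP; split.
  by apply/opnorm_leP => //; apply: vbound_diag_compression; rewrite ?ler0c.
by rewrite -lecR -dk; exact: diag_compression_attained Eu (vbound_opnorm _).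
Qed.

End Opnorm.

(** * The extremal pair *)

(** For e = 1 and e = -1 these are the matrices A and B, in the basis z, x, y.
    When e^2 = 1 the last row is e sqrt 2 times the middle one, so that the
    matrix has rank one. *)
Definition extremal_mx (C : numClosedFieldType) (e : C) : 'M[C]_3 :=
  \matrix_(i, j) nth 0 (nth [::] [:: [:: 0; 0; 0];
                                     [:: sqrtC 2; e; 0];
                                     [:: 2 * e; sqrtC 2; 0]] i) j.

Definition diag3 (C : numClosedFieldType) (a b c : C) : 'M[C]_3 :=
  diag_mx (\row_j nth 0 [:: a; b; c] j).

Section Extremal.
Variable C : numClosedFieldType.
Local Notation s := (sqrtC 2 : C).
Local Notation A := (extremal_mx 1 : 'M[C]_3).
Local Notation B := (extremal_mx (-1) : 'M[C]_3).

Let s2 : s * s = 2. Proof. by rewrite -expr2 sqrtCK. Qed.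
Let sJ : s^*%R = s. Proof. by rewrite conj_Creal // ger0_real // sqrtC_ge0. Qed.

(** A rank-one matrix is its only singular value times a partial isometry; here
    that value is 3, the square root of the sum 2 + 1 + 4 + 2 of the squared
    entries. *)
Lemma extremal_scaled_pisometry (e : C) : e * e = 1 -> e^*%R = e ->
  scaled_pisometry 3 (extremal_mx e).
Proof.
move=> e2 eJ; split; first by rewrite ltr0n.
apply/matrixP=> i j; rewrite !(mxE, big_ord_recl, big_ord0) /=.
case: i => [[|[|[|//]]] ?]; case: j => [[|[|[|//]]] ?] /=.
all: rewrite ?rmorphM /= ?rmorph0 ?rmorph_nat /= ?sJ ?eJ.
all: try ring.
all: ring: s2 e2.
Qed.

(** The cross terms carry the factor e and cancel between A and B. *)
Lemma extremal_gram_sum :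
  (A^t* *m A + A *m A^t*) + (B^t* *m B + B *m B^t*) = 12 *: 1%:M.
Proof.
apply/matrixP=> i j; rewrite !(mxE, big_ord_recl, big_ord0) /=.
case: i => [[|[|[|//]]] ?]; case: j => [[|[|[|//]]] ?] /=.
all: rewrite ?rmorphM ?rmorphN ?rmorph0 ?rmorph1 ?rmorph_nat /= ?sJ.
all: try ring.
all: ring: s2.
Qed.

Lemma extremal_sum_scaled_pisometry : scaled_pisometry (2 * s) (A + B).
Proof.
split; first by rewrite mulr_gt0 ?sqrtC_gt0 ?ltr0n.
apply/matrixP=> i j; rewrite !(mxE, big_ord_recl, big_ord0) /=.
case: i => [[|[|[|//]]] ?]; case: j => [[|[|[|//]]] ?] /=.
all: rewrite ?rmorphD ?rmorphM /= ?rmorphN ?rmorph0 ?rmorph1 ?rmorph_nat /= ?sJ.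
all: try ring.
all: ring: s2.
Qed.

Lemma extremal_sum_gram :
  (A + B)^t* *m (A + B) + (A + B) *m (A + B)^t* = 8 *: diag3 1 2 1.
Proof.
apply/matrixP=> i j; rewrite !(mxE, big_ord_recl, big_ord0) /=.
case: i => [[|[|[|//]]] ?]; case: j => [[|[|[|//]]] ?] /=.
all: rewrite ?rmorphD ?rmorphM /= ?rmorphN ?rmorph0 ?rmorph1 ?rmorph_nat /= ?sJ.
all: try ring.
all: ring: s2.
Qed.

Lemma extremal_gram_average :
  gram_average 3 A + gram_average 3 B = diag_mx (const_mx 2).
Proof.
rewrite /gram_average -scalerDr extremal_gram_sum scalerA diag_const_mx.
have -> : (2 * 3)^-1 * 12 = 2 :> C by field.
by rewrite scalemx1.
Qed.

Lemma extremal_sum_gram_average :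
  gram_average (2 * s) (A + B) = diag_mx (\row_j nth 0 [:: s; s * 2; s] j).
Proof.
rewrite /gram_average extremal_sum_gram scalerA.
have -> : (2 * (2 * s))^-1 * 8 = s.
  have s_neq0 : s != 0 by rewrite sqrtC_eq0 pnatr_eq0.
  by apply: (mulfI s_neq0); rewrite s2; field.
rewrite -linearZ; congr diag_mx; apply/rowP=> j; rewrite !mxE.
by case: j => [[|[|[|//]]] ?] /=; rewrite ?mulr1.
Qed.

Lemma extremal_sum_diag_le (j : 'I_3) :
  `|(\row_j nth 0 [:: s; s * 2; s] j : 'rV[C]_3) 0 j| <= s * 2.
Proof.
have s_gt0 : 0 < s by rewrite sqrtC_gt0 ltr0n.
rewrite mxE ger0_norm; last first.
  by case: j => [[|[|[|//]]] ?] /=; rewrite ?mulr_ge0 ?ler0n ?ltW.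
by case: j => [[|[|[|//]]] ?] /=; rewrite // ler_peMr ?ler1n // ltW.
Qed.

Lemma extremal_scaled_pisometry_plus : scaled_pisometry 3 A.
Proof. by apply: extremal_scaled_pisometry; rewrite ?rmorph1 ?mulr1. Qed.

Lemma extremal_scaled_pisometry_minus : scaled_pisometry 3 B.
Proof.
by apply: extremal_scaled_pisometry; rewrite ?rmorphN ?rmorph1 ?mulrNN ?mulr1.
Qed.

End Extremal.

(** * Attaining the constant *)

Section Attained.
Variables (R : realType) (n : nat) (E : 'M[R[i]]_(3, n)).
Hypothesis Eu : E \is unitarymx.
Local Notation s := (sqrtC 2 : R[i]).
Local Notation A := (extremal_mx (1 : R[i])).
Local Notation B := (extremal_mx (-1 : R[i])).

Lemma opnorm_symmodmx_extremal :
  opnorm (symmodmx (compression E A) + symmodmx (compression E B)) = 2.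
Proof.
have -> := symmodmx_compression_add Eu (extremal_scaled_pisometry_plus _)
  (extremal_scaled_pisometry_minus _) (extremal_gram_average _).
have two : (2 : R)%:C = 2 by rewrite rmorph_nat.
apply: (opnorm_diag_compression (k := ord0) Eu) => [||j].
- exact: ler0n.
- by rewrite mxE two normr_nat.
- by rewrite mxE two normr_nat.
Qed.

Lemma sqrtC2_sqrt2 : s = (Num.sqrt 2)%:C.
Proof.
rewrite -[RHS]sqrCK; last by rewrite ler0c sqrtr_ge0.
by rewrite -rmorphXn /= sqr_sqrtr ?ler0n // rmorph_nat.
Qed.

Lemma opnorm_symmodmx_extremal_sum :
  opnorm (symmodmx (compression E A + compression E B)) = Num.sqrt 2 * 2.
Proof.
have cE : (Num.sqrt 2 * 2)%:C = s * 2 :> R[i].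
  by rewrite sqrtC2_sqrt2 rmorphM /= rmorph_nat.
have -> := symmodmx_add_compression Eu (extremal_sum_scaled_pisometry _)
  (extremal_sum_gram_average _).
(* The largest entry of diag(1, 2, 1) is the one of index 1. *)
apply: (opnorm_diag_compression (k := 1) Eu) => [||j].
- by rewrite mulr_ge0 ?sqrtr_ge0 ?ler0n.
- by rewrite mxE /= cE ger0_norm // mulr_ge0 ?ler0n // sqrtC_ge0 ler0n.
- by rewrite cE; exact: extremal_sum_diag_le.
Qed.

End Attained.

(** Stated for all coisometries E at once: E = 1 gives the matrices of size 3, and
    the corners their direct sums with zero. *)
Lemma extremal_pair (R : realType) :
  exists A B : 'M[R[i]]_3, A <> 0 /\
    forall (n : nat) (E : 'M[R[i]]_(3, n)), E \is unitarymx ->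
      opnorm (symmodmx (compression E A + compression E B)) = Num.sqrt 2 * 2 /\
      opnorm (symmodmx (compression E A) + symmodmx (compression E B)) = 2.
Proof.
exists (extremal_mx 1), (extremal_mx (-1)); split=> [A0|n E Eu].
  by have /matrixP/(_ 1 1)/eqP := A0; rewrite !mxE /= oner_eq0.
split; first exact: opnorm_symmodmx_extremal_sum.
exact: opnorm_symmodmx_extremal.
Qed.

Lemma big_ord_first_two (V : nmodType) (m : nat) (F : 'I_m.+2 -> V) :
  (forall k : 'I_m, F (lift ord0 (lift ord0 k)) = 0) ->
  \sum_(k < m.+2) F k = F ord0 + F (lift ord0 ord0).
Proof. by move=> F0; rewrite !big_ord_recl big1 ?addr0. Qed.

Lemma symmodmx_sum_two (R : realType) (m n : nat) (N : 'M[R[i]]_n -> R) (c : R) :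
  (2 <= m)%N ->
  (forall A : 'I_m -> 'M[R[i]]_n,
     N (symmodmx (\sum_(k < m) A k)) <= c * N (\sum_(k < m) symmodmx (A k))) ->
  forall A B : 'M[R[i]]_n,
    N (symmodmx (A + B)) <= c * N (symmodmx A + symmodmx B).
Proof.
case: m => [|[|m]] // _ le_c A B.
pose F (k : 'I_m.+2) := match val k with 0 => A | 1 => B | _ => 0 end.
have sumE : \sum_(k < m.+2) F k = A + B by apply: big_ord_first_two.
have modE : \sum_(k < m.+2) symmodmx (F k) = symmodmx A + symmodmx B.
  by apply: big_ord_first_two => k; rewrite /F /= symmodmx0.
by rewrite -sumE -modE; exact: le_c.
Qed.

Unset Implicit Arguments.

Theorem theorem2p5 (R : realType) :
  (forall m n : nat, (2 <= m)%N -> (3 <= n)%N ->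
     ~ exists2 c : R, c < Num.sqrt 2 &
         forall N : 'M[R[i]]_n -> R, is_norm N -> unitarily_invariant N ->
         forall A : 'I_m -> 'M[R[i]]_n,
           N (symmodmx (\sum_(k < m) A k))
             <= c * N (\sum_(k < m) symmodmx (A k)))
  /\
  (exists A B : 'M[R[i]]_3,
     [/\ ~ (A = 0 /\ B = 0),
         opnorm (symmodmx (A + B))
           = Num.sqrt 2 * opnorm (symmodmx A + symmodmx B)
       & forall (n : nat) (n_gt3 : (3 < n)%N),
           let An := dsum0 (ltnW n_gt3) A in
           let Bn := dsum0 (ltnW n_gt3) B in
           opnorm (symmodmx (An + Bn))
             = Num.sqrt 2 * opnorm (symmodmx An + symmodmx Bn)]).
Proof.
have [A [B [A0 AB]]] := extremal_pair R; split=> [m n m_ge2 n_ge3 [c c_lt le_c]|].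
  have [sumE modE] := AB _ _ (corner_mx_unitary _ n_ge3).
  have le2 := le_c _ (@opnorm_is_norm R n) (@opnorm_unitarily_invariant R n).
  have := symmodmx_sum_two m_ge2 le2 (compression (corner_mx _ n_ge3) A)
    (compression (corner_mx _ n_ge3) B).
  by rewrite sumE modE ler_pM2r ?ltr0n // leNgt c_lt.
exists A, B; split=> [[//]||n n_gt3 /=].
- have E1 : (1%:M : 'M[R[i]]_3) \is unitarymx.
    by apply/unitarymxP; rewrite trmx1 map_mx1 mulmx1.
  have := AB _ _ E1; rewrite /compression trmx1 map_mx1 !mul1mx !mulmx1.
  by case=> -> ->.
- rewrite !dsum0_compression.
  by have [-> ->] := AB _ _ (corner_mx_unitary _ (ltnW n_gt3)).
Qed.
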